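(* Let $n\in\mathbb{N}$ be a multiple of $4$, let $T=\{x\in\{0,1\}^n : |x|=n/2\}$ be the half slice, and let $f:T\to\{0,1\}$ be such that \[ \Pr_{x,y\sim\{0,1\}^n}\bigl[f(x+y)=f(x)+f(y)\;\big|\;x,y,x+y\in T\bigr]=\frac{1+\delta}{2}. \] Then there exists $u\in\{0,1\}^n$ such that \[ \Pr_{x\sim\{0,1\}^n}\bigl[f(x)=x\cdot u\;\big|\;x\in T\bigr]\;\geq\;\frac{1+\delta}{2}-o(1). \]
   Context: $|x|$ denotes the Hamming weight of $x\in\{0,1\}^n$; addition of vectors and the value $f(x)+f(y)$ are taken modulo $2$; $x\cdot u=\sum_i x_iu_i \bmod 2$. In the probability, $x,y$ are uniform in $\{0,1\}^n$ conditioned on the event $x,y,x+y\in T$. The term $o(1)$ denotes a quantity depending only on $n$ (not on $f$) that tends to $0$ as $n\to\infty$. *)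

(* Defs.v *)
From HB Require Import structures.
From mathcomp Require Import all_boot all_order all_algebra.
From mathcomp Require Import reals.

Set Implicit Arguments.
Unset Strict Implicit.
Unset Printing Implicit Defensive.

Import GRing.Theory.
Local Open Scope ring_scope.

Definition hweight (n : nat) (x : 'rV['F_2]_n) : nat :=
  #|[pred i : 'I_n | x 0 i != 0]|.

Definition half_slice (n : nat) : {set 'rV['F_2]_n} :=
  [set x | hweight x == n./2].

Definition dotv (n : nat) (x u : 'rV['F_2]_n) : 'F_2 :=
  \sum_(i < n) x 0 i * u 0 i.

Definition uprob (R : realType) (Omega : finType) (A : pred Omega) : R :=
  #|A|%:R / #|Omega|%:R.

(* Conditioning on an empty event gives 0, as division by 0 does. *)
Definition ucprob (R : realType) (Omega : finType) (A B : pred Omega) : R :=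
  uprob R (predI A B) / uprob R B.

(* Main.v *)
(* Put F = (-1)^f and, for u in F_2^n, phi(u) = E_{x in T} F(x) chi_u(x) and
   mu(u) = E_{x in T} chi_u(x).  As on the whole cube, sum_u phi(u)^3 = K delta with
   K = sum_u mu(u)^3; the all-ones character is trivial on T, so phi(u + 1) = phi(u), and K is
   2 - o(1).  Parseval alone is too weak, since sum_u phi(u)^2 = 2^n / |T| has order sqrt n.
   Instead, let P be the sum of phi^3 over {phi > 0}, and apply Cauchy-Schwarz on T to
   P = E_{x in T} F(x) h(x), where h is the sum of phi(u)^2 chi_u over {phi > 0}:
     P^2 <= sum_{u,v} phi(u)^2 phi(v)^2 mu(u + v), over u, v with phi(u), phi(v) > 0.
   The pairs with u + v in {0, 1} contribute at most 2 (max phi) P.  When u + v has weight 2 or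
   n - 2, mu(u + v) = -1/(n-1) is negative and can be dropped, and for the other pairs
   mu(u + v) <= 3/((n-1)(n-3)), so they contribute at most
   3/((n-1)(n-3)) (2^n / |T|)^2 = O(1/n).
   Hence K delta <= P <= 2 max phi + O(n^(-1/2)). *)

Require Import Defs.
From HB Require Import structures.
From mathcomp Require Import all_boot all_order all_algebra all_fingroup.
From mathcomp Require Import reals topology normedtype sequences realfun.
From mathcomp Require Import ring lra zify.

Set Implicit Arguments.
Unset Strict Implicit.
Unset Printing Implicit Defensive.

Import Order.TTheory GRing.Theory Num.Theory.
Import numFieldNormedType.Exports.
Local Open Scope classical_set_scope.
Local Open Scope ring_scope.

(** * Arithmetic of vectors over ['F_2] *)

Lemma F2_cases (a : 'F_2) : a = 0 \/ a = 1.
Proof. by case: a => [[|[|m]] Hm] //; [left|right]; apply/val_inj. Qed.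

Lemma F2_add11 : 1 + 1 = 0 :> 'F_2.
Proof. exact/val_inj. Qed.

Lemma F2_addrr n (x : 'rV['F_2]_n) : x + x = 0.
Proof.
by apply/rowP => i; rewrite !mxE; case: (F2_cases (x 0 i)) => ->; rewrite ?addr0 ?F2_add11.
Qed.

Lemma F2_add_eq0 n (x y : 'rV['F_2]_n) : (x + y == 0) = (y == x).
Proof.
apply/eqP/eqP => [xy0|->]; last exact: F2_addrr.
by rewrite -[y]add0r -(F2_addrr x) -addrA xy0 addr0.
Qed.

Lemma F2_addKr n (x y : 'rV['F_2]_n) : x + y + y = x.
Proof. by rewrite -addrA F2_addrr addr0. Qed.

Notation "''e_' i" := (delta_mx 0 i : 'rV['F_2]_ _)
  (at level 8, i at level 2, format "''e_' i").

(** * Characters of the cube and Fourier coefficients relative to a subset *)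

Section Characters.
Variables (R : realType) (n : nat).
Local Notation V := 'rV['F_2]_n.

Definition sgF (a : 'F_2) : R := (-1) ^+ (a != 0).

Lemma sgFD a b : sgF (a + b) = sgF a * sgF b.
Proof.
rewrite /sgF; case: (F2_cases a) => ->; case: (F2_cases b) => ->;
  by rewrite ?F2_add11 ?add0r ?addr0 ?eqxx ?oner_eq0 /= ?expr0 ?expr1 ?mulr1 ?mul1r ?mulrNN ?mulr1.
Qed.

Lemma sgF0 : sgF 0 = 1.
Proof. by rewrite /sgF eqxx. Qed.

Lemma sgF1 : sgF 1 = -1.
Proof. by rewrite /sgF oner_eq0 expr1. Qed.

Lemma sgF_sqr a : sgF a ^+ 2 = 1.
Proof. by rewrite /sgF -exprM mulnC exprM sqrrN expr1n expr1n. Qed.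

Lemma sgF_eq a b : (a == b)%:R = (1 + sgF a * sgF b) / 2 :> R.
Proof.
case: (F2_cases a) => ->; case: (F2_cases b) => ->;
  by rewrite ?sgF0 ?sgF1 ?eqxx ?oner_eq0 1?[0 == 1]eq_sym ?oner_eq0 /=; lra.
Qed.

Definition chi (u x : V) : R := sgF (dotv x u).

Lemma chiDr u x y : chi u (x + y) = chi u x * chi u y.
Proof.
rewrite /chi -sgFD; congr sgF; rewrite /dotv -big_split /=.
by apply: eq_bigr => i _; rewrite mxE mulrDl.
Qed.

Lemma chiDl u v x : chi (u + v) x = chi u x * chi v x.
Proof.
rewrite /chi -sgFD; congr sgF; rewrite /dotv -big_split /=.
by apply: eq_bigr => i _; rewrite mxE mulrDr.
Qed.

Lemma chi_delta i x : chi 'e_i x = sgF (x 0 i).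
Proof.
rewrite /chi; congr sgF; rewrite /dotv (bigD1 i) //= big1 => [|j /negPf ji].
  by rewrite mxE !eqxx mulr1 addr0.
by rewrite mxE ji andbF mulr0.
Qed.

Lemma chi0 x : chi 0 x = 1.
Proof.
by rewrite /chi /dotv big1 ?sgF0 // => i _; rewrite mxE mulr0.
Qed.

Lemma sum_chi x : \sum_u chi u x = if x == 0 then 2 ^+ n else 0.
Proof.
case: eqP => [->|/eqP x0].
  rewrite (eq_bigr (fun=> 1)) => [|u _]; last first.
    by rewrite /chi /dotv big1 ?sgF0 // => i _; rewrite mxE mul0r.
  by rewrite sumr_const card_mx card_Fp // mul1n natrX.
have [i xi] : exists i, x 0 i != 0.
  apply/existsP; apply: contraNT x0; rewrite negb_exists => /forallP h.
  by apply/eqP/rowP => i; rewrite mxE; apply/eqP; rewrite -[_ == _]negbK h.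
have xi1 : x 0 i = 1 by case: (F2_cases (x 0 i)) => // e; rewrite e eqxx in xi.
(* Translating [u] by ['e_i], with [x 0 i = 1], flips the sign of every term. *)
have : \sum_u chi u x = - \sum_u chi u x.
  rewrite {1}(reindex_inj (addIr 'e_i)) /= -sumrN; apply: eq_bigr => u _.
  by rewrite chiDl chi_delta xi1 sgF1 mulrN1.
by lra.
Qed.

Section Fourier.
Variable A : {set V}.
Hypothesis A_gt0 : (0 < #|A|)%N.
Local Notation N := (#|A|%:R : R).

(** The average is over [A], not over the cube; hence the factors [2 ^+ n / N] in the identities
    below. With [A] the half slice this is phi for the signs [F], and mu for the constant 1. *)
Definition hat (F : V -> R) (u : V) : R := N^-1 * \sum_(x in A) F x * chi u x.

Let N_neq0 : N != 0.
Proof. by rewrite pnatr_eq0 -lt0n. Qed.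

Lemma sum_hat F : \sum_u hat F u = if 0 \in A then N^-1 * 2 ^+ n * F 0 else 0.
Proof.
rewrite -mulr_sumr exchange_big /=.
under eq_bigr => x _ do rewrite -mulr_sumr sum_chi.
case: ifPn => A0; last first.
  rewrite big1 ?mulr0 // => x xA; case: eqP => [x0|]; last by rewrite mulr0.
  by rewrite -x0 xA in A0.
rewrite (bigD1 0) //= eqxx big1 ?addr0 => [|x /andP[_ /negPf ->]]; last by rewrite mulr0.
by rewrite mulrA; ring.
Qed.

(** Parseval: expanding the square, orthogonality of characters keeps only the pairs with
    [y = x]. *)
Lemma sum_hat_sqr F : (forall x, F x ^+ 2 = 1) -> \sum_u hat F u ^+ 2 = 2 ^+ n / N.
Proof.
move=> F1.
transitivity (\sum_u N^-2 * \sum_(x in A) \sum_(y in A) F x * F y * chi u (x + y)).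
  apply: eq_bigr => u _; rewrite /hat exprMn -exprVn; congr (_ * _).
  rewrite expr2 mulr_suml; apply: eq_bigr => x _; rewrite mulr_sumr.
  by apply: eq_bigr => y _; rewrite chiDr; ring.
rewrite -mulr_sumr exchange_big /=.
rewrite (eq_bigr (fun=> 2 ^+ n)) => [|x xA]; last first.
  rewrite exchange_big /= (bigD1 x) //= -mulr_sumr F2_addrr sum_chi eqxx -expr2 F1 mul1r.
  rewrite big1 ?addr0 // => y /andP[_ /negPf yx].
  by rewrite -mulr_sumr sum_chi F2_add_eq0 yx mulr0.
by rewrite sumr_const -[_ *+ #|A|]mulr_natr; field.
Qed.

(** Orthogonality keeps only the triples with [z = x + y]. Taken for the signs of [f] and for the
    constant 1, the two right-hand sides have ratio delta. *)
Lemma sum_hat_cube F :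
  \sum_u hat F u ^+ 3 =
  2 ^+ n / N ^+ 3 *
  \sum_(p : V * V | [&& p.1 \in A, p.2 \in A & p.1 + p.2 \in A])
     F (p.1 + p.2) * (F p.1 * F p.2).
Proof.
transitivity (\sum_u N^-3 *
    \sum_(x in A) \sum_(y in A) \sum_(z in A) F x * F y * F z * chi u (x + y + z)).
  apply: eq_bigr => u _; rewrite /hat exprMn -exprVn; congr (_ * _).
  rewrite exprSr expr2 -mulrA mulr_suml; apply: eq_bigr => x _.
  rewrite mulr_suml mulr_sumr; apply: eq_bigr => y _; rewrite !mulr_sumr.
  by apply: eq_bigr => z _; rewrite !chiDr; ring.
rewrite -mulr_sumr exchange_big /= [2 ^+ n / _]mulrC -mulrA; congr (_ * _).
rewrite mulr_sumr [RHS]big_mkcond /=.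
rewrite -(pair_bigA _ (fun x y => if [&& x \in A, y \in A & x + y \in A]
  then 2 ^+ n * (F (x + y) * (F x * F y)) else 0)) /=.
rewrite big_mkcond /=; apply: eq_bigr => x _; case: ifP => xA /=; last first.
  by rewrite big1.
rewrite exchange_big big_mkcond /=; apply: eq_bigr => y _; case: ifP => yA //=.
rewrite exchange_big /=; under eq_bigr => z _ do rewrite -mulr_sumr sum_chi F2_add_eq0.
case: ifP => xyA.
  rewrite (bigD1 (x + y)) //= eqxx big1 ?addr0 => [|z /andP[_ /negPf ->]]; first by ring.
  by rewrite mulr0.
by rewrite big1 // => z zA; case: eqP => [zxy|]; [rewrite -zxy zA in xyA|rewrite mulr0].
Qed.

(** Cauchy-Schwarz on [A]: the left side is the squared mean of [F * h] with [h] the sum of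
    [c u * chi u], and the right side is the mean of [h ^+ 2]. *)
Lemma sqr_sum_hat F (c : V -> R) : (forall x, F x ^+ 2 = 1) ->
  (\sum_u c u * hat F u) ^+ 2 <= \sum_u \sum_v c u * c v * hat (fun=> 1) (u + v).
Proof.
move=> F1; pose h x := \sum_u c u * chi u x.
have -> : \sum_u c u * hat F u = N^-1 * \sum_(x in A) F x * h x.
  rewrite mulr_sumr; under eq_bigr => u _ do rewrite /hat !mulr_sumr.
  rewrite exchange_big /=; apply: eq_bigr => x _; rewrite !mulr_sumr.
  by apply: eq_bigr => u _; ring.
have -> : \sum_u \sum_v c u * c v * hat (fun=> 1) (u + v) = N^-1 * \sum_(x in A) h x ^+ 2.
  under eq_bigr => u _ do under eq_bigr => v _ do rewrite /hat !mulr_sumr.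
  under eq_bigr => u _ do rewrite exchange_big /=.
  rewrite exchange_big /= mulr_sumr; apply: eq_bigr => x _.
  rewrite expr2 /h mulr_suml mulr_sumr; apply: eq_bigr => u _.
  by rewrite !mulr_sumr; apply: eq_bigr => v _; rewrite chiDl; ring.
(* [a] is the mean of [F * h]; nonnegativity of the variance gives the inequality. *)
set a := N^-1 * _.
have : 0 <= N^-1 * \sum_(x in A) (F x * h x - a) ^+ 2.
  by rewrite mulr_ge0 ?invr_ge0 // sumr_ge0 // => x _; exact: sqr_ge0.
rewrite (eq_bigr (fun x => h x ^+ 2 + (- a *+ 2 * (F x * h x) + a ^+ 2))) => [|x _]; last first.
  by rewrite sqrrB exprMn F1 mul1r; ring.
rewrite big_split /= big_split /= -mulr_sumr sumr_const -[a ^+ 2 *+ _]mulr_natr.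
have -> : \sum_(x in A) F x * h x = N * a by rewrite /a; field.
rewrite mulrDr; set H := N^-1 * \sum_(x in A) h x ^+ 2.
have -> : N^-1 * (- a *+ 2 * (N * a) + a ^+ 2 * N) = - a ^+ 2 by field.
by rewrite subr_ge0.
Qed.

End Fourier.
End Characters.

(** * Hamming weight and the size of the half slice *)

Section Weight.
Variable n : nat.
Local Notation V := 'rV['F_2]_n.
Local Notation ones := (const_mx 1 : V).

Lemma hweightE (x : V) : hweight x = (\sum_i (x 0 i != 0)%R)%N.
Proof.
rewrite /hweight -sum1_card big_mkcond /=.
by apply: eq_bigr => i _; rewrite inE; case: (x 0 i != 0).
Qed.

Lemma F2_neq0 (a : 'F_2) : a != 0 -> a = 1.
Proof. by case: (F2_cases a) => -> //; rewrite eqxx. Qed.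

Lemma hweight_xcol i j (x : V) : hweight (xcol i j x) = hweight x.
Proof.
rewrite !hweightE (reindex_inj (@perm_inj _ (tperm i j))) /=.
by apply: eq_bigr => k _; rewrite mxE tpermK.
Qed.

Lemma hweight_del (x : V) i : x 0 i != 0 -> hweight x = (hweight (x + 'e_i)).+1.
Proof.
move=> xi; rewrite !hweightE (bigD1 i) //= [in RHS](bigD1 i) //= !mxE !eqxx /=.
rewrite xi (F2_neq0 xi) F2_add11 eqxx add1n add0n; congr S.
by apply: eq_bigr => j /negPf ji; rewrite !mxE ji andbF addr0.
Qed.

Lemma hweight_compl (x : V) : hweight (x + ones) = (n - hweight x)%N.
Proof.
suff : (hweight (x + ones) + hweight x)%N = n by lia.
rewrite !hweightE -big_split /= (eq_bigr (fun=> 1%N)); first by rewrite sum1_card card_ord.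
by move=> i _; rewrite !mxE; case: (F2_cases (x 0 i)) => ->;
  rewrite ?F2_add11 ?add0r ?eqxx ?oner_eq0.
Qed.

Lemma hweight_gt0 (x : V) : (0 < hweight x)%N -> exists i, x 0 i != 0.
Proof. by rewrite /hweight => /card_gt0P[i]; rewrite inE; exists i. Qed.

Lemma hweight_eq0 (x : V) : (hweight x == 0%N) = (x == 0).
Proof.
apply/eqP/eqP => [|->].
  move/card0_eq => x0; apply/rowP => i; rewrite mxE; apply/eqP.
  by move: (x0 i); rewrite inE => /negbFE.
by apply: eq_card0 => i; rewrite inE mxE eqxx.
Qed.

Lemma card_half_slice : #|half_slice n| = 'C(n, n./2).
Proof.
pose s (x : V) := [set i | x 0 i != 0]; pose r (B : {set 'I_n}) : V := \row_i (i \in B)%:R.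
have rK : cancel r s.
  by move=> B; apply/setP => i; rewrite inE mxE; case: (i \in B); rewrite ?eqxx ?oner_eq0.
have sK : cancel s r.
  move=> x; apply/rowP => i; rewrite mxE inE.
  by case: (F2_cases (x 0 i)) => ->; rewrite ?eqxx ?oner_eq0.
rewrite -[X in 'C(X, _)]card_ord -card_draws -(card_imset _ (can_inj rK)); apply: eq_card => x.
apply/idP/imsetP => [|[B]]; rewrite inE => /eqP xw.
  exists (s x); last by rewrite sK.
  by rewrite inE -xw cardsE.
by move=> ->; rewrite inE -xw -{2}(rK B) cardsE.
Qed.

Lemma half_slice_gt0 : (0 < #|half_slice n|)%N.
Proof. by rewrite card_half_slice bin_gt0 -divn2 leq_div. Qed.

End Weight.

(** Induction with (k + 1) C(2k + 2, k + 1) = 2 (2k + 1) C(2k, k); the step reduces to 4k(k + 1) <=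
    (2k + 1)^2. *)
Lemma central_bin_ge k : (0 < k)%N -> (4 ^ k * 4 ^ k <= 4 * k * ('C(k.*2, k) * 'C(k.*2, k)))%N.
Proof.
case: k => // k _; elim: k => // k IH.
have e : (k.+2 * 'C(k.+2.*2, k.+2) = 2 * (k.+1.*2).+1 * 'C(k.+1.*2, k.+1))%N.
  have h1 := mul_bin_diag (k.+1.*2).+2 k.+1.
  have h2 := mul_bin_down (k.+1.*2).+1 k.+1.
  move: h1 h2; rewrite doubleS /= => <- h2; rewrite -mulnA h2; lia.
set a := 'C(k.+2.*2, _) in e *; set b := 'C(k.+1.*2, _) in e IH *.
rewrite -(leq_pmul2l (ltn0Sn k.+1)).
have -> : (k.+2 * (4 * k.+2 * (a * a)) = 4 * ((k.+2 * a) * (k.+2 * a)))%N by ring.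
rewrite e [(4 ^ k.+2)%N]expnS; set p := (4 ^ k.+1)%N in IH *.
nia.
Qed.

(** * Character averages [mu] on the half slice *)

Section HalfSlice.
Variables (R : realType) (n : nat).
Local Notation V := 'rV['F_2]_n.
Local Notation ones := (const_mx 1 : V).
Local Notation T := (half_slice n).
Hypothesis n4 : (4 %| n)%N.
Hypothesis n_gt0 : (0 < n)%N.

Definition mu (u : V) : R := hat T (fun=> 1) u.

Lemma half_slice_dense : (2 ^+ n / #|T|%:R) ^+ 2 <= 2 * n%:R :> R.
Proof.
have h : (0 < n./2)%N by lia.
have T0 : 0 < #|T|%:R :> R by rewrite ltr0n half_slice_gt0.
rewrite expr_div_n ler_pdivrMr ?exprn_gt0 //.
have := central_bin_ge h; have nE : (n./2.*2 = n)%N by lia.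
rewrite nE -card_half_slice -(ler_nat R) !natrM.
have -> : (4 ^ n./2)%:R = 2 ^+ n :> R.
  by rewrite -{2}nE -muln2 mulnC exprM natrX; congr (_ ^+ _); rewrite -natrX.
have -> : n%:R = 2 * (n./2)%:R :> R by rewrite -natrM; congr (_ %:R); lia.
by rewrite !expr2; lra.
Qed.

Lemma zero_notin_half_slice : (0 : V) \notin T.
Proof.
rewrite inE; have /eqP -> : hweight (0 : V) == 0%N by rewrite hweight_eq0.
by lia.
Qed.

Lemma mu0 : mu 0 = 1.
Proof.
rewrite /mu /hat; under eq_bigr => x _ do rewrite chi0 mulr1.
by rewrite sumr_const mulVf // pnatr_eq0 -lt0n half_slice_gt0.
Qed.

(** Since 4 divides [n], the weight [n./2] is even. *)
Lemma chi_ones (x : V) : x \in T -> chi R ones x = 1.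
Proof.
rewrite inE => /eqP xT.
have -> : chi R ones x = (-1) ^+ hweight x.
  rewrite /chi /dotv hweightE.
  rewrite (big_morph (sgF R) (@sgFD R) (sgF0 R)).
  rewrite (big_morph (fun k => (-1 : R) ^+ k) (@exprD R _) (expr0 _)).
  by apply: eq_bigr => i _; rewrite mxE mulr1.
have [m ->] : exists m, hweight x = (2 * m)%N by exists (n %/ 4)%N; rewrite xT; lia.
by rewrite exprM sqrrN expr1n expr1n.
Qed.

Lemma hat_compl F u : hat T F (u + ones) = hat T F u :> R.
Proof.
by congr (_ * _); apply: eq_bigr => x xT; rewrite chiDl chi_ones // mulr1.
Qed.

(** The half slice is invariant under exchanging coordinates [i] and [j], which carries [u + 'e_i]
    to [u + 'e_j]. *)
Lemma mu_swap (u : V) i j : u 0 i = u 0 j -> mu (u + 'e_i) = mu (u + 'e_j).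
Proof.
move=> uij; congr (_ * _).
have xcolK : involutive (xcol i j : V -> V).
  by move=> x; apply/rowP => k; rewrite !mxE tpermK.
rewrite (reindex_inj (inv_inj xcolK)) /=.
apply: eq_big => [x|x _]; first by rewrite !inE hweight_xcol.
congr (_ * sgF _ _); rewrite /dotv (reindex_inj (@perm_inj _ (tperm i j))) /=.
apply: eq_bigr => k _; rewrite !mxE tpermK; congr (_ * (_ + _)).
  by case: tpermP => [->|->|].
rewrite eqxx /=; congr (_ %:R); congr nat_of_bool.
by case: tpermP => [->|->|/eqP/negPf-> /eqP/negPf->] //; rewrite ?eqxx // eq_sym.
Qed.

(* On T the signs (-1)^(x_i) sum to 0. *)
Lemma sum_mu (u : V) : \sum_i mu (u + 'e_i) = 0.
Proof.
rewrite -mulr_sumr exchange_big /= big1 ?mulr0 // => x xT.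
under eq_bigr => i _ do rewrite mul1r chiDl chi_delta.
rewrite -mulr_sumr.
have -> : \sum_i sgF R (x 0 i) = n%:R - 2 * (hweight x)%:R.
  rewrite (eq_bigr (fun i => 1 - 2 * (x 0 i != 0)%:R)) => [|i _].
    by rewrite sumrB sumr_const card_ord -mulr_sumr -natr_sum hweightE.
  by rewrite /sgF; case: (x 0 i != 0); rewrite ?expr0 ?expr1 /=; lra.
move: xT; rewrite inE => /eqP ->.
have -> : n%:R = 2 * (n./2)%:R :> R by rewrite -natrM; congr (_ %:R); lia.
by rewrite subrr mulr0.
Qed.

(* By symmetry [sum_mu] at [v + e_i] involves only the two values [mu v] and
   [mu (v + e_i + e_j)]: this is the recurrence (n - k + 1) mu_k = - (k - 1) mu_(k-2). *)
Lemma mu_step (v : V) i j : v 0 i != 0 -> (v + 'e_i) 0 j != 0 ->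
  (n%:R - (hweight v)%:R + 1) * mu v = - ((hweight v)%:R - 1) * mu (v + 'e_i + 'e_j).
Proof.
move=> vi vj; pose u := v + 'e_i.
have ui : u 0 i = 0 by rewrite !mxE (F2_neq0 vi) !eqxx F2_add11.
have hu : (hweight v)%:R = (hweight u)%:R + 1 :> R by rewrite (hweight_del vi) natr1.
have := sum_mu u.
rewrite (eq_bigr (fun k => mu v + (u 0 k != 0)%:R * (mu (u + 'e_j) - mu v))) => [|k _].
  rewrite big_split /= sumr_const card_ord -mulr_suml -natr_sum -hweightE hu.
  by rewrite -mulr_natl -/u => h; lra.
case: (F2_cases (u 0 k)) => uk; rewrite uk ?eqxx ?oner_eq0 /=.
  by rewrite mul0r addr0 (@mu_swap u k i) ?uk ?ui // F2_addKr.
by rewrite mul1r addrCA subrr addr0 (@mu_swap u k j) // uk (F2_neq0 vj).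
Qed.

Lemma hweight_del2 (v : V) : (1 < hweight v)%N ->
  exists i j, [/\ v 0 i != 0, (v + 'e_i) 0 j != 0 & hweight v = (hweight (v + 'e_i + 'e_j)).+2].
Proof.
move=> v2; have [i vi] := hweight_gt0 (ltnW v2).
have [j vj] : exists j, (v + 'e_i) 0 j != 0 by apply: hweight_gt0; rewrite (hweight_del vi) in v2.
by exists i, j; split=> //; rewrite (hweight_del vi) (hweight_del vj).
Qed.

(** By symmetry the [n] terms of [sum_mu] at 0 are all equal to [mu v]. *)
Lemma mu_weight1 (v : V) : hweight v = 1%N -> mu v = 0.
Proof.
move=> v1; have [i vi] : exists i, v 0 i != 0 by apply: hweight_gt0; rewrite v1.
have ve : v = 0 + 'e_i.
  rewrite add0r; apply/esym/eqP; rewrite -F2_add_eq0 -hweight_eq0.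
  by move: v1; rewrite (hweight_del vi) => -[->].
have := sum_mu 0; rewrite (eq_bigr (fun=> mu v)) => [|k _].
  rewrite sumr_const card_ord => /eqP; rewrite mulrn_eq0 => /orP[/eqP n0|/eqP //].
  by move: (n_gt0); rewrite n0.
by rewrite ve; apply: mu_swap; rewrite !mxE.
Qed.

Lemma mu_weight2 (v : V) : hweight v = 2%N -> mu v = - (n%:R - 1)^-1.
Proof.
move=> v2; have [|i [j [vi vj vw]]] := @hweight_del2 v; first by rewrite v2.
have := mu_step vi vj; move: vw; rewrite v2 => -[/esym/eqP]; rewrite hweight_eq0 => /eqP ->.
rewrite mu0 => h; have n3 : 4 <= n%:R :> R by rewrite ler_nat; lia.
have n1 : n%:R - 1 != 0 :> R by apply/lt0r_neq0; lra.
apply: (mulfI n1); rewrite mulrN divff //.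
by move: h; rewrite (_ : n%:R - 2%:R + 1 = n%:R - 1 :> R); lra.
Qed.

(** The recurrence [mu_step] multiplies absolute values by (k - 1)/(n - k + 1), which is at most 1
    for k <= n/2. So the bound propagates from weights 3 and 4, where [mu] is 0 and 3/((n - 1)(n -
    3)). *)
Lemma mu_weight_ge3 (v : V) : (2 < hweight v <= n./2)%N -> `|mu v| <= 3 / ((n%:R - 1) * (n%:R - 3)).
Proof.
have n3 : 4 <= n%:R :> R by rewrite ler_nat; lia.
have b0 : 0 <= 3 / ((n%:R - 1) * (n%:R - 3)) :> R by rewrite divr_ge0 // mulr_ge0; lra.
move: {2}(hweight v) (leqnn (hweight v)) => k; elim: k v => [|k IH] v vk /andP[v2 vn].
  by lia.
have [|i [j [vi vj vw]]] := @hweight_del2 v; first by lia.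
have := mu_step vi vj; set w := v + _ + _ in vw *.
have dn : 2 * (hweight v)%:R <= n%:R :> R by rewrite -natrM ler_nat; lia.
have w3 : 3 <= (hweight v)%:R :> R by rewrite ler_nat; lia.
move=> h; have [w4|w5] := leqP (hweight v) 4.
  have [v3|v4] : hweight v = 3%N \/ hweight v = 4%N by lia.
    move: h; rewrite (@mu_weight1 w); last by lia.
    rewrite mulr0 => /eqP; rewrite mulf_eq0 => /orP[/eqP|/eqP -> ]; first by lra.
    by rewrite normr0.
  move: h; rewrite (@mu_weight2 w); last by lia.
  rewrite v4 => h.
  suff -> : mu v = 3 / ((n%:R - 1) * (n%:R - 3)) by rewrite ger0_norm.
  have n1 : n%:R - 1 != 0 :> R by apply/lt0r_neq0; lra.
  have n3' : n%:R - 3 != 0 :> R by apply/lt0r_neq0; lra.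
  apply: (mulfI n3'); rewrite (_ : n%:R - 3 = n%:R - 4%:R + 1 :> R) ?h; last by lra.
  by field; rewrite n1 andbT; apply/lt0r_neq0; lra.
have wb : `|mu w| <= 3 / ((n%:R - 1) * (n%:R - 3)) by apply: IH; lia.
apply: le_trans wb.
have a0 : 0 < n%:R - (hweight v)%:R + 1 :> R by lra.
rewrite -(ler_pM2l a0) -{1}(gtr0_norm a0) -normrM h mulNr normrN normrM.
by rewrite ler_wpM2r // ger0_norm; lra.
Qed.

(** Complementing [v] preserves [mu], so weights up to [n./2] suffice. The first bound is one-sided
    because at weight 2 the value -1/(n - 1) is large in size but negative. *)
Lemma mu_bounds (v : V) : v != 0 -> v != ones ->
  mu v <= 3 / ((n%:R - 1) * (n%:R - 3)) /\ `|mu v| <= (n%:R - 1)^-1.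
Proof.
have n3 : 4 <= n%:R :> R by rewrite ler_nat; lia.
wlog vn : v / (hweight v <= n./2)%N => [hw|] v0 v1.
  have [/hw|vn] := leqP (hweight v) n./2; first exact.
  rewrite /mu -(hat_compl _ v) -/(mu _); apply: hw.
  - by rewrite hweight_compl; lia.
  - by rewrite F2_add_eq0 eq_sym.
  - by rewrite -subr_eq0 addrK.
have b0 : 0 <= 3 / ((n%:R - 1) * (n%:R - 3)) :> R by rewrite divr_ge0 // mulr_ge0; lra.
have c0 : 0 <= (n%:R - 1)^-1 :> R by rewrite invr_ge0; lra.
have vp : (0 < hweight v)%N by rewrite lt0n hweight_eq0.
have [v2|v3] := leqP (hweight v) 2.
  have [/mu_weight1 ->|/mu_weight2 ->] : hweight v = 1%N \/ hweight v = 2%N by lia.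
    by rewrite normr0.
  by rewrite normrN ger0_norm //; split=> //; lra.
have h : `|mu v| <= 3 / ((n%:R - 1) * (n%:R - 3)) by apply: mu_weight_ge3; rewrite v3.
split; first exact: le_trans (ler_norm _) h.
(* Weight at least 3 and at most [n./2] forces n >= 6, whence 3/(n - 3) <= 1. *)
apply: (le_trans h); have n6 : 6 <= n%:R :> R by rewrite ler_nat; lia.
by rewrite invfM mulrCA ger_pMr ?invr_gt0 ?ler_pdivrMr; lra.
Qed.

(** * Cubic sums of Fourier coefficients on the half slice *)

Lemma sum_mu_cube : 2 - 2 ^+ n / #|T|%:R / (n%:R - 1) <= \sum_u mu (u : V) ^+ 3.
Proof.
have n3 : 4 <= n%:R :> R by rewrite ler_nat; lia.
have ones0 : ones != 0.
  apply/eqP => /rowP/(_ (Ordinal n_gt0)); rewrite !mxE => /eqP.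
  by rewrite oner_eq0.
have mu1 : mu ones = 1 by rewrite -[ones]add0r /mu hat_compl // -/(mu _) mu0.
(* The two trivial characters contribute 1 each. Elsewhere mu^3 >= - mu^2/(n - 1), and Parseval sums
   these errors. *)
have -> : 2 - 2 ^+ n / #|T|%:R / (n%:R - 1) =
    \sum_u ((u == 0 :> V)%:R + (u == ones)%:R - mu u ^+ 2 / (n%:R - 1)).
  rewrite sumrB big_split /= -mulr_suml sum_hat_sqr ?half_slice_gt0 //; last first.
    by move=> x; rewrite expr1n.
  have sum1 (a : V) : \sum_u (u == a)%:R = 1 :> R.
    by rewrite (bigD1 a) //= eqxx big1 ?addr0 // => u /negPf ->.
  by rewrite !sum1.
apply: ler_sum => u _.
have i0 : 0 <= (n%:R - 1)^-1 :> R by rewrite invr_ge0; lra.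
have [->|u0] := eqVneq u 0.
  by rewrite mu0 // [0 == ones]eq_sym (negPf ones0) !expr1n mul1r /=; lra.
have [->|u1] := eqVneq u ones; first by rewrite mu1 !expr1n mul1r /=; lra.
have [_ /ler_normlP[h _]] := mu_bounds u0 u1.
rewrite /= addr0 sub0r -mulrN [mu u ^+ 3]exprSr ler_wpM2l ?sqr_ge0 //; lra.
Qed.

(** [P] is the sum of phi^3 over phi > 0, written with the weights [c]; the factor [2 * n%:R] bounds
    the square of 2^n/|T|. *)
Lemma sum_hat_cube_le (F : V -> R) (M : R) : (forall x, F x ^+ 2 = 1) ->
  (forall u, hat T F u <= M) ->
  exists P, [/\ 0 <= P, \sum_u hat T F u ^+ 3 <= P &
    P ^+ 2 <= 2 * M * P + 3 / ((n%:R - 1) * (n%:R - 3)) * (2 * n%:R)].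
Proof.
move=> F1 FM; set e := 3 / _.
have n3 : 4 <= n%:R :> R by rewrite ler_nat; lia.
have e0 : 0 <= e by rewrite divr_ge0 // mulr_ge0; lra.
pose c u := if 0 < hat T F u then hat T F u ^+ 2 else 0.
have c0 u : 0 <= c u by rewrite /c; case: ifP => // _; exact: sqr_ge0.
have c1 u : c (u + ones) = c u by rewrite /c hat_compl.
have cle u : c u <= hat T F u ^+ 2 by rewrite /c; case: ifP => // _; exact: sqr_ge0.
exists (\sum_u c u * hat T F u); split.
- apply: sumr_ge0 => u _; rewrite /c; case: ifP => [h|_]; last by rewrite mul0r.
  by rewrite mulr_ge0 ?sqr_ge0 // ltW.
- apply: ler_sum => u _; rewrite /c exprSr; case: ltP => // h; rewrite mul0r.
  by rewrite mulr_ge0_le0 ?sqr_ge0.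
apply: le_trans (sqr_sum_hat (half_slice_gt0 _) c F1) _.
apply: (@le_trans _ _ (\sum_u (2 * M * (c u * hat T F u) + e * c u * \sum_v c v))).
  apply: ler_sum => u _.
  (* The indicators absorb the two [v] at which [mu (u + v)] is 1; [e] bounds it from above at all
     others. *)
  apply: (@le_trans _ _ (\sum_v (c u * c v * ((v == u)%:R + (v == u + ones)%:R + e)))).
    apply: ler_sum => v _; apply: ler_wpM2l; first exact: mulr_ge0.
    have [vu|vu] := eqVneq v u.
      by rewrite vu F2_addrr -/(mu 0) mu0 //; case: (_ == _); rewrite /=; lra.
    have [vu1|vu1] := eqVneq v (u + ones).
      by rewrite vu1 addrA F2_addrr hat_compl // -/(mu 0) mu0 //=; lra.
    have [||h _] := @mu_bounds (u + v).
    - by rewrite F2_add_eq0.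
    - apply: contraNneq vu1 => <-.
      by rewrite addrA F2_addrr add0r.
    - by rewrite /= !add0r.
  have sel a : \sum_v c u * c v * (v == a)%:R = c u * c a.
    rewrite (bigD1 a) //= eqxx mulr1 big1 ?addr0 // => v /negPf ->.
    by rewrite mulr0.
  under eq_bigr => v _ do rewrite !mulrDr.
  rewrite !big_split /= !sel c1 -mulr_suml -mulr_sumr.
  suff : c u * c u <= M * (c u * hat T F u) by lra.
  have := FM u; have := c0 u; rewrite [M * _]mulrCA.
  case: (ltP 0 (hat T F u)) => [h c0u hM|h _ _].
    by rewrite ler_wpM2l // /c h expr2 ler_wpM2r // ltW.
  by rewrite {1 3}/c ltNge h /= !mul0r.
(* What remains is the square of the sum of [c], at most that of the sum of phi^2, which Parseval
   and the density of the slice control. *)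
rewrite big_split /= -mulr_sumr lerD2l -mulr_suml -mulr_sumr -mulrA ler_wpM2l //.
apply: le_trans (half_slice_dense).
rewrite -(sum_hat_sqr (half_slice_gt0 _) F1) -expr2 ler_sqr ?nnegrE ?ler_sum // sumr_ge0 // => u _.
exact: sqr_ge0.
Qed.

(** [s] is (n + 1)^(-1/2), entering only through its square so that the estimates stay
    polynomial. *)
Lemma linear_correlation (F : V -> R) (delta s : R) :
  (forall x, F x ^+ 2 = 1) -> delta <= 1 -> 0 <= s -> s ^+ 2 = n.+1%:R^-1 ->
  \sum_u hat T F u ^+ 3 = (\sum_u mu (u : V) ^+ 3) * delta ->
  exists u, delta - 6 * s <= hat T F u.
Proof.
move=> F1 d1 s0 s2 cubeE; pose u0 := [arg max_(u > (0 : V)) hat T F u]%O.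
have n3 : 4 <= n%:R :> R by rewrite ler_nat; lia.
have FM u : hat T F u <= hat T F u0.
  by rewrite /u0; case: arg_maxP => //= v _; apply.
exists u0; set M := hat T F u0 in FM *.
(* [hat T F] sums to 0 because 0 is not in T. *)
have M0 : 0 <= M.
  rewrite leNgt; apply/negP => Mlt0.
  have := sum_hat T F; rewrite (negPf zero_notin_half_slice) => sum0.
  have : \sum_u hat T F u <= \sum_(u : V) M by apply: ler_sum => u _; exact: FM.
  rewrite sum0 sumr_const -mulr_natr pmulr_lge0 ?ltr0n; first by rewrite leNgt Mlt0.
  by apply/card_gt0P; exists 0.
(* For negative delta, [M0] already suffices. *)
have [dlt0|d0] := ltP delta 0; first by lra.
have [P [P0 cubeP P2]] := sum_hat_cube_le F1 FM.
have s2n : s ^+ 2 * (n%:R + 1) = 1 by rewrite s2 -natr1 mulVf // lt0r_neq0 //; lra.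
have e64 : 3 / ((n%:R - 1) * (n%:R - 3)) * (2 * n%:R) <= (8 * s) ^+ 2.
  rewrite mulrAC ler_pdivrMr; last by rewrite mulr_gt0; lra.
  rewrite -(ler_pM2r (_ : 0 < n%:R + 1)); last by lra.
  have -> : (8 * s) ^+ 2 * ((n%:R - 1) * (n%:R - 3)) * (n%:R + 1) =
    64 * ((n%:R - 1) * (n%:R - 3)) * (s ^+ 2 * (n%:R + 1)) by ring.
  by rewrite s2n; nra.
(* Otherwise P (P - 2M) would exceed (8s)^2. *)
have P8 : P <= 2 * M + 8 * s.
  rewrite leNgt; apply/negP => h; nra.
set D : R := 2 ^+ n / #|T|%:R / (n%:R - 1).
have D3 : D <= 3 * s.
  have D0 : 0 <= D.
    by rewrite /D divr_ge0 ?divr_ge0 ?exprn_ge0 ?ler0n //; lra.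
  have s30 : 0 <= 3 * s by lra.
  rewrite -ler_sqr ?nnegrE //.
  rewrite /D expr_div_n ler_pdivrMr; last by rewrite exprn_gt0; lra.
  apply: (le_trans (half_slice_dense)).
  rewrite -(ler_pM2r (_ : 0 < n%:R + 1)); last by lra.
  have -> : (3 * s) ^+ 2 * (n%:R - 1) ^+ 2 * (n%:R + 1) =
    9 * (n%:R - 1) ^+ 2 * (s ^+ 2 * (n%:R + 1)) by ring.
  by rewrite s2n; nra.
have := sum_mu_cube; rewrite -/D => K.
have : (2 - 3 * s) * delta <= P.
  by apply: le_trans cubeP; rewrite cubeE; apply: ler_wpM2r => //; lra.
(* From (2 - 3s) delta <= 2M + 8s and 0 <= delta <= 1 follows delta - 11s/2 <= M. *)
nra.
Qed.

End HalfSlice.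

(** * From conditional probabilities to sums of signs *)

Lemma ucprobE (R : realType) (Omega : finType) (A B : pred Omega) :
  ucprob R A B = (\sum_(x | B x) (A x)%:R) / #|B|%:R.
Proof.
have -> : \sum_(x | B x) (A x)%:R = #|predI A B|%:R :> R.
  rewrite -natr_sum -sum1_card [in RHS]big_mkcond [in LHS]big_mkcond /=.
  by congr (_ %:R); apply: eq_bigr => x _; rewrite !inE; case: (A x); case: (B x).
rewrite /ucprob /uprob.
have [B0|B0] := eqVneq #|B| 0%N; first by rewrite B0 !mul0r !invr0 !mulr0.
have O0 : #|Omega|%:R != 0 :> R.
  by rewrite pnatr_eq0 -lt0n (leq_trans _ (max_card B)) // lt0n.
by field; rewrite O0 pnatr_eq0 B0.
Qed.

(* f is given on all of F_2^n; only its values on the half slice occur. *)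
Theorem theorem1p1 (R : realType) :
  exists eps : nat -> R,
    (eps n @[n --> \oo] --> (0 : R)) /\
    forall n : nat, (4 %| n)%N ->
    forall (f : 'rV['F_2]_n -> 'F_2) (delta : R),
      ucprob R
        (fun p : 'rV['F_2]_n * 'rV['F_2]_n => f (p.1 + p.2) == f p.1 + f p.2)
        (fun p => [&& p.1 \in half_slice n, p.2 \in half_slice n
                    & p.1 + p.2 \in half_slice n])
      = (1 + delta) / 2 ->
      exists u : 'rV['F_2]_n,
        ucprob R (fun x => f x == dotv x u) (fun x => x \in half_slice n)
        >= (1 + delta) / 2 - eps n.
Proof.
(* Half of the loss [6 * s] in [linear_correlation], as a probability is (1 + correlation)/2. *)
exists (fun n => 3 * Num.sqrt (n.+1%:R^-1)); split.
  rewrite -[X in _ --> X](mulr0 3) -[X in 3 * X](@sqrtr0 R); apply: cvgMl_tmp.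
  have /= := @continuous_cvg _ _ _ \oo _ (fun n => n.+1%:R^-1 : R) (@Num.sqrt R) 0.
  apply; first exact: sqrt_continuous.
  exact: cvg_harmonic.
move=> n n4 f delta; set B : pred _ := fun p => [&& _, _ & _]; pose s : R := Num.sqrt (n.+1%:R^-1).
rewrite ucprobE -/s => dE.
have s0 : 0 <= s by exact: sqrtr_ge0.
have s2 : s ^+ 2 = n.+1%:R^-1 by rewrite sqr_sqrtr // invr_ge0.
have d1 : delta <= 1.
  suff : (1 + delta) / 2 <= 1 by lra.
  rewrite -dE; have [->|B0] := eqVneq #|B| 0%N; first by rewrite invr0 mulr0.
  rewrite ler_pdivrMr ?ltr0n ?lt0n // mul1r -sumr_const.
  by apply: ler_sum => p _; case: (_ == _).
(* At n = 0 the error term is 3, so the lower bound is negative. *)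
have [n0|n_gt0] := posnP n.
  exists 0; have s1 : s = 1 by rewrite /s n0 invr1 sqrtr1.
  apply: (@le_trans _ _ 0); first by rewrite s1; lra.
  by rewrite ucprobE divr_ge0 ?sumr_ge0 // => x _; exact: ler0n.
pose F x := sgF R (f x).
have F1 x : F x ^+ 2 = 1 by exact: sgF_sqr.
(* If [B] is empty the convention forces delta = -1, but both sides still vanish. *)
have sumB : \sum_(p | B p) F (p.1 + p.2) * (F p.1 * F p.2) = #|B|%:R * delta.
  have [B0|B0] := eqVneq #|B| 0%N.
    by rewrite B0 mul0r big_pred0 // => p; exact: (card0_eq B0 p).
  have B0' : #|B|%:R != 0 :> R by rewrite pnatr_eq0.
  move: dE; under eq_bigr => p _ do rewrite sgF_eq sgFD.
  rewrite -mulr_suml big_split /= sumr_const -/F; set S := \sum_(p | B p) _ => dE.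
  have -> : S = ((#|B|%:R + S) / 2 / #|B|%:R) * (2 * #|B|%:R) - #|B|%:R by field.
  by rewrite dE; field.
(* Both cubic sums carry the same prefactor, and for the constant 1 the remaining sum is [#|B|]. *)
have cube : \sum_u hat (half_slice n) F u ^+ 3 = (\sum_u mu R (u : 'rV_n) ^+ 3) * delta.
  rewrite !sum_hat_cube sumB.
  under [X in _ = _ * X * _]eq_bigr => p _ do rewrite !mulr1.
  by rewrite sumr_const mulrA.
have [u hu] := linear_correlation n4 n_gt0 F1 d1 s0 s2 cube.
exists u; rewrite ucprobE.
under eq_bigr => x _ do rewrite sgF_eq.
have T0 : #|half_slice n|%:R != 0 :> R by rewrite pnatr_eq0 -lt0n half_slice_gt0.
rewrite -mulr_suml big_split /= sumr_const.
have -> : \sum_(x in half_slice n) sgF R (f x) * sgF R (dotv x u) =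
   #|half_slice n|%:R * hat (half_slice n) F u by rewrite /hat mulrA divff // mul1r.
rewrite [X in _ <= X](_ : _ = (1 + hat (half_slice n) F u) / 2); last by field.
lra.
Qed.
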